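(* For every PLTL formula $W$, the number of PLTL-clauses generated by the translation $\tau_0[W]$ into SNF (i.e. the number of conjuncts $\Box A_i$ in $\tau_0[W]$) is at most $1+11\cdot\mathrm{len}(W)$.
   Context: PLTL formulae are built from proposition symbols, $\mathbf{true}$, $\mathbf{false}$, $\neg,\vee,\wedge,\Rightarrow$ and temporal operators $\bigcirc$ (next), $\Diamond$ (sometime), $\Box$ (always), $\mathcal{U}$ (until), $\mathcal{W}$ (unless); $\mathbf{start}$ is a nullary connective true only at the first moment. A literal is a proposition symbol or its negation. A PLTL-clause is a formula $\mathbf{start}\Rightarrow\bigvee_c l_c$, $\bigwedge_a k_a\Rightarrow\bigcirc\bigvee_d l_d$ or $\bigwedge_b k_b\Rightarrow\Diamond l$ with all $k,l$ literals. The translation: $\tau_0[A]=\Box(\mathbf{start}\Rightarrow y)\wedge\tau_1[\Box(y\Rightarrow A)]$ with $y$ a fresh proposition symbol, where $\tau_1$, applied to $\Box(x\Rightarrow W)$ ($x$ a proposition symbol), is computed by applying the following rewrite rules repeatedly until the result is a conjunction of formulae $\Box A_i$, each $A_i$ a PLTL-clause (write $\tau_1[x\Rightarrow A]$ for $\tau_1[\Box(x\Rightarrow A)]$; $y,z,v$ are proposition symbols new at each application; $l,m,l_i$ literals; $\neg\mathbf{true}$, $\neg\mathbf{false}$ rewritten to $\mathbf{false}$, $\mathbf{true}$). (1) $x\Rightarrow(A\wedge B)\mapsto\tau_1[x\Rightarrow A]\wedge\tau_1[x\Rightarrow B]$; $x\Rightarrow(A\Rightarrow B)\mapsto\tau_1[x\Rightarrow\neg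 A\vee B]$; $x\Rightarrow\neg(A\wedge B)\mapsto\tau_1[x\Rightarrow\neg A\vee\neg B]$; $x\Rightarrow\neg(A\Rightarrow B)\mapsto\tau_1[x\Rightarrow A]\wedge\tau_1[x\Rightarrow\neg B]$; $x\Rightarrow\neg(A\vee B)\mapsto\tau_1[x\Rightarrow\neg A]\wedge\tau_1[x\Rightarrow\neg B]$. (2) $x\Rightarrow\bigcirc A\mapsto\Box(x\Rightarrow\bigcirc y)\wedge\tau_1[y\Rightarrow A]$ if $A$ is neither a literal nor a disjunction of literals; $x\Rightarrow\neg\bigcirc A\mapsto\Box(x\Rightarrow\bigcirc y)\wedge\tau_1[y\Rightarrow\neg A]$; $x\Rightarrow\Box A\mapsto\tau_1[x\Rightarrow\Box y]\wedge\tau_1[y\Rightarrow A]$ ($A$ not a literal); $x\Rightarrow\neg\Box A\mapsto\Box(x\Rightarrow\Diamond y)\wedge\tau_1[y\Rightarrow\neg A]$; $x\Rightarrow\Diamond A\mapsto\Box(x\Rightarrow\Diamond y)\wedge\tau_1[y\Rightarrow A]$ ($A$ not a literal); $x\Rightarrow\neg\Diamond A\mapsto\tau_1[x\Rightarrow\Box y]\wedge\tau_1[y\Rightarrow\neg A]$; $x\Rightarrow A\,\mathcal{U}\,B\mapsto\tau_1[x\Rightarrow y\,\mathcal{U}\,B]\wedge\tau_1[y\Rightarrow A]$ ($A$ not a literal), $\mapsto\tau_1[x\Rightarrow A\,\mathcal{U}\,y]\wedge\tau_1[y\Rightarrow B]$ ($B$ not a literal); the same with $\mathcal{W}$ for $\mathcal{U}$;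 $x\Rightarrow\neg(A\,\mathcal{U}\,B)\mapsto\tau_1[x\Rightarrow y\,\mathcal{W}\,v]\wedge\tau_1[y\Rightarrow\neg B]\wedge\tau_1[v\Rightarrow(y\wedge z)]\wedge\tau_1[z\Rightarrow\neg A]$; $x\Rightarrow\neg(A\,\mathcal{W}\,B)\mapsto\tau_1[x\Rightarrow y\,\mathcal{U}\,v]\wedge\tau_1[y\Rightarrow\neg B]\wedge\tau_1[v\Rightarrow(y\wedge z)]\wedge\tau_1[z\Rightarrow\neg A]$. (3) $x\Rightarrow\Box l\mapsto\tau_1[x\Rightarrow l]\wedge\tau_1[x\Rightarrow y]\wedge\Box(y\Rightarrow\bigcirc l)\wedge\Box(y\Rightarrow\bigcirc y)$; $x\Rightarrow l\,\mathcal{U}\,m\mapsto\Box(x\Rightarrow\Diamond m)\wedge\tau_1[x\Rightarrow l\vee m]\wedge\tau_1[x\Rightarrow y\vee m]\wedge\Box(y\Rightarrow\bigcirc(l\vee m))\wedge\Box(y\Rightarrow\bigcirc(y\vee m))$; $x\Rightarrow l\,\mathcal{W}\,m\mapsto$ the same without $\Box(x\Rightarrow\Diamond m)$. (4) $x\Rightarrow D\vee A\mapsto\tau_1[x\Rightarrow D\vee y]\wedge\tau_1[y\Rightarrow A]$, $D$ a disjunction, $A$ neither a literal nor a disjunction of literals. (5) $x\Rightarrow D\mapsto\Box(\mathbf{start}\Rightarrow\neg x\vee D)\wedge\Box(\mathbf{true}\Rightarrow\bigcirc(\neg x\vee D))$ for $D$ a literal or disjunction of literals; $x\Rightarrow\mathbf{true}\mapsto\Box(\mathbf{start}\Rightarrow\mathbf{true})\wedge\Box(\mathbf{true}\Rightarrow\bigcirc\mathbf{true})$;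 $x\Rightarrow\mathbf{false}\mapsto\Box(\mathbf{start}\Rightarrow\neg x)\wedge\Box(\mathbf{true}\Rightarrow\bigcirc\neg x)$; $\tau_1[x\Rightarrow\Diamond l]=\Box(x\Rightarrow\Diamond l)$; $\tau_1[x\Rightarrow\bigcirc(l_1\vee\dots\vee l_n)]=\Box(x\Rightarrow\bigcirc(l_1\vee\dots\vee l_n))$. Length: $\mathrm{len}(\Diamond l)=1$; $\mathrm{len}(l_1\vee\dots\vee l_n)=1$ ($n\ge1$); $\mathrm{len}(c)=1$ for $c\in\{\mathbf{true},\neg\mathbf{true},\mathbf{false},\neg\mathbf{false}\}$; $\mathrm{len}(\bigcirc(l_1\vee\dots\vee l_n))=1$; $\mathrm{len}(\neg\Box A)=\mathrm{len}(\neg\Diamond A)=\mathrm{len}(\neg\bigcirc A)=1+\mathrm{len}(\neg A)$; $\mathrm{len}(\Box A)=1+\mathrm{len}(A)$; $\mathrm{len}(\Diamond A)=1+\mathrm{len}(A)$ ($A$ not a literal); $\mathrm{len}(\bigcirc A)=1+\mathrm{len}(A)$ ($A$ not a disjunction of literals); for $\circ\in\{\mathcal{U},\mathcal{W},\vee,\wedge\}$: $\mathrm{len}(\neg(A\circ B))=1+\mathrm{len}(\neg A)+\mathrm{len}(\neg B)$ and $\mathrm{len}(A\circ B)=1+\mathrm{len}(A)+\mathrm{len}(B)$ (for $\vee$: $A,B$ not disjunctions of literals); $\mathrm{len}(\neg(A\Rightarrow B))=1+\mathrm{len}(A)+\mathrm{len}(\neg B)$; $\mathrm{len}(A\Rightarrow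 B)=1+\mathrm{len}(\neg A)+\mathrm{len}(B)$. *)

(* Defs.v *)
From mathcomp Require Import all_boot zify.
From Stdlib Require Relation_Operators.

Set Implicit Arguments.
Unset Strict Implicit.
Unset Printing Implicit Defensive.

(* Proposition symbols: a countably infinite supply. *)
Definition sym := nat.

Inductive unop := ONot | ONext | OSometime | OAlways.
Inductive binop := OOr | OAnd | OImp | OUntil | OUnless.

(* The nullary connective [start] is not a constructor: it occurs only in
   clauses (see [Initial] below), never in a formula to be translated. *)
Inductive form :=
  | Var of sym
  | Tru
  | Fls
  | Un of unop & form
  | Bin of binop & form & form.

Notation Not A := (Un ONot A).
Notation Next A := (Un ONext A).
Notation Sometime A := (Un OSometime A).
Notation Always A := (Un OAlways A).
Notation Or A B := (Bin OOr A B).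
Notation And A B := (Bin OAnd A B).
Notation Imp A B := (Bin OImp A B).
Notation Until A B := (Bin OUntil A B).
Notation Unless A B := (Bin OUnless A B).

Fixpoint syms (A : form) : seq sym :=
  match A with
  | Var p => [:: p]
  | Tru | Fls => [::]
  | Un _ B => syms B
  | Bin _ B C => syms B ++ syms C
  end.

Definition literal (A : form) : bool :=
  match A with
  | Var _ | Not (Var _) => true
  | _ => false
  end.

(* Disjunctions of n >= 1 literals, with any bracketing; a literal is the case
   n = 1. *)
Fixpoint lit_disj (A : form) : bool :=
  match A with
  | Or B C => lit_disj B && lit_disj C
  | _ => literal A
  end.

Fixpoint lit_conj (A : form) : bool :=
  match A with
  | And B C => lit_conj B && lit_conj C
  | _ => literal A
  end.

Definition is_Tru (A : form) : bool := if A is Tru then true else false.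

(* [nlen A] is the length of [Not A]; a double negation is transparent.  The
   two functions are mutually recursive because negation is pushed inwards. *)
Fixpoint len (A : form) : nat :=
  match A with
  | Var _ | Tru | Fls => 1
  | Not B => nlen B
  | Next B => if lit_disj B then 1 else 1 + len B
  | Sometime B => if literal B then 1 else 1 + len B
  | Always B => 1 + len B
  | Or B C => if lit_disj B && lit_disj C then 1 else 1 + len B + len C
  | Imp B C => 1 + nlen B + len C
  | And B C | Until B C | Unless B C => 1 + len B + len C
  end
with nlen (A : form) : nat :=
  match A with
  | Var _ | Tru | Fls => 1
  | Not B => len B
  | Next B | Sometime B | Always B => 1 + nlen B
  | Imp B C => 1 + len B + nlen C
  | Or B C | And B C | Until B C | Unless B C => 1 + nlen B + nlen C
  end.

Inductive clause :=
  | Initial of form             (* start => D *)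
  | Stepwise of form & form     (* K => Next D *)
  | Eventual of form & form.    (* K => Sometime l *)

(* [Tru] is the empty conjunction on the left; it is also accepted on the
   right, because translating x => true yields start => true and
   true => Next true. *)
Definition pltl_clause (c : clause) : bool :=
  match c with
  | Initial D => is_Tru D || lit_disj D
  | Stepwise K D => (is_Tru K || lit_conj K) && (is_Tru D || lit_disj D)
  | Eventual K l => (is_Tru K || lit_conj K) && literal l
  end.

(* [Done c] is the conjunct Always c, left alone by the translation;
   [Todo x A] is the conjunct tau_1 [Always (x => A)]. *)
Inductive conjunct :=
  | Done of clause
  | Todo of sym & form.

(* One simplification of negated constants or of a double negation, at an
   arbitrary position. *)
Inductive simplify : form -> form -> Prop :=
  | simplify_not_tru : simplify (Not Tru) Fls
  | simplify_not_fls : simplify (Not Fls) Tru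
  | simplify_not_not A : simplify (Not (Not A)) A
  | simplify_un o A A' : simplify A A' -> simplify (Un o A) (Un o A')
  | simplify_binl o A A' B : simplify A A' ->
      simplify (Bin o A B) (Bin o A' B)
  | simplify_binr o A B B' : simplify B B' ->
      simplify (Bin o A B) (Bin o A B').

(* [replace_disjunct A A' E E']: A occurs in E strictly below a nonempty tree
   of disjunctions, and E' is E with that occurrence replaced by A'.  So E is
   of the shape "D or A" up to reordering, for a nonempty disjunction D. *)
Inductive replace_disjunct (A A' : form) : form -> form -> Prop :=
  | replace_here_l B : replace_disjunct A A' (Or A B) (Or A' B)
  | replace_here_r B : replace_disjunct A A' (Or B A) (Or B A')
  | replace_below_l E E' B : replace_disjunct A A' E E' ->
      replace_disjunct A A' (Or E B) (Or E' B)
  | replace_below_r E E' B : replace_disjunct A A' E E' ->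
      replace_disjunct A A' (Or B E) (Or B E').

(* [rule x A ys r]: the conjunct tau_1 [Always (x => A)] may be rewritten to
   the conjunction r, where ys lists the new symbols of this application. *)
Inductive rule (x : sym) : form -> seq sym -> seq conjunct -> Prop :=
  | rule_simplify A A' : simplify A A' ->
      rule x A [::] [:: Todo x A']
  | rule_and A B :
      rule x (And A B) [::] [:: Todo x A; Todo x B]
  | rule_imp A B :
      rule x (Imp A B) [::] [:: Todo x (Or (Not A) B)]
  | rule_not_and A B :
      rule x (Not (And A B)) [::] [:: Todo x (Or (Not A) (Not B))]
  | rule_not_imp A B :
      rule x (Not (Imp A B)) [::] [:: Todo x A; Todo x (Not B)]
  | rule_not_or A B :
      rule x (Not (Or A B)) [::] [:: Todo x (Not A); Todo x (Not B)]
  | rule_next A y : ~~ lit_disj A ->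
      rule x (Next A) [:: y] [:: Done (Stepwise (Var x) (Var y)); Todo y A]
  | rule_not_next A y :
      rule x (Not (Next A)) [:: y]
        [:: Done (Stepwise (Var x) (Var y)); Todo y (Not A)]
  | rule_always A y : ~~ literal A ->
      rule x (Always A) [:: y] [:: Todo x (Always (Var y)); Todo y A]
  | rule_not_always A y :
      rule x (Not (Always A)) [:: y]
        [:: Done (Eventual (Var x) (Var y)); Todo y (Not A)]
  | rule_sometime A y : ~~ literal A ->
      rule x (Sometime A) [:: y]
        [:: Done (Eventual (Var x) (Var y)); Todo y A]
  | rule_not_sometime A y :
      rule x (Not (Sometime A)) [:: y]
        [:: Todo x (Always (Var y)); Todo y (Not A)]
  | rule_until_l A B y : ~~ literal A ->
      rule x (Until A B) [:: y] [:: Todo x (Until (Var y) B); Todo y A]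
  | rule_until_r A B y : ~~ literal B ->
      rule x (Until A B) [:: y] [:: Todo x (Until A (Var y)); Todo y B]
  | rule_unless_l A B y : ~~ literal A ->
      rule x (Unless A B) [:: y] [:: Todo x (Unless (Var y) B); Todo y A]
  | rule_unless_r A B y : ~~ literal B ->
      rule x (Unless A B) [:: y] [:: Todo x (Unless A (Var y)); Todo y B]
  | rule_not_until A B y z v :
      rule x (Not (Until A B)) [:: y; z; v]
        [:: Todo x (Unless (Var y) (Var v)); Todo y (Not B);
            Todo v (And (Var y) (Var z)); Todo z (Not A)]
  | rule_not_unless A B y z v :
      rule x (Not (Unless A B)) [:: y; z; v]
        [:: Todo x (Until (Var y) (Var v)); Todo y (Not B);
            Todo v (And (Var y) (Var z)); Todo z (Not A)]
  | rule_always_lit l y : literal l ->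
      rule x (Always l) [:: y]
        [:: Todo x l; Todo x (Var y);
            Done (Stepwise (Var y) l); Done (Stepwise (Var y) (Var y))]
  | rule_until_lit l m y : literal l -> literal m ->
      rule x (Until l m) [:: y]
        [:: Done (Eventual (Var x) m); Todo x (Or l m); Todo x (Or (Var y) m);
            Done (Stepwise (Var y) (Or l m));
            Done (Stepwise (Var y) (Or (Var y) m))]
  | rule_unless_lit l m y : literal l -> literal m ->
      rule x (Unless l m) [:: y]
        [:: Todo x (Or l m); Todo x (Or (Var y) m);
            Done (Stepwise (Var y) (Or l m));
            Done (Stepwise (Var y) (Or (Var y) m))]
  | rule_or A E E' y : ~~ lit_disj A -> replace_disjunct A (Var y) E E' ->
      rule x E [:: y] [:: Todo x E'; Todo y A]
  | rule_lit_disj D : lit_disj D ->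
      rule x D [::] [:: Done (Initial (Or (Not (Var x)) D));
                        Done (Stepwise Tru (Or (Not (Var x)) D))]
  | rule_tru :
      rule x Tru [::] [:: Done (Initial Tru); Done (Stepwise Tru Tru)]
  | rule_fls :
      rule x Fls [::] [:: Done (Initial (Not (Var x)));
                          Done (Stepwise Tru (Not (Var x)))]
  | rule_sometime_lit l : literal l ->
      rule x (Sometime l) [::] [:: Done (Eventual (Var x) l)]
  | rule_next_lit_disj D : lit_disj D ->
      rule x (Next D) [::] [:: Done (Stepwise (Var x) D)].

(* A state is the list of symbols used so far with the current conjunction. *)
Definition state := (seq sym * seq conjunct)%type.

Inductive step : state -> state -> Prop :=
  | step_rule U s1 s2 x A ys r :
      rule x A ys r -> uniq ys -> all [pred y | y \notin U] ys ->
      step (U, s1 ++ Todo x A :: s2) (ys ++ U, s1 ++ r ++ s2).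

Definition steps : state -> state -> Prop :=
  Relation_Operators.clos_refl_trans_1n state step.

(* [tau0 W cs]: some run of the translation of W ends with the conjunction of
   the formulae Always c, for c in cs. *)
Definition tau0 (W : form) (cs : seq clause) : Prop :=
  exists (y : sym) (U : seq sym),
    [/\ y \notin syms W,
        steps (y :: syms W, [:: Done (Initial (Var y)); Todo y W])
              (U, map Done cs)
      & all pltl_clause cs].

(* The remainder shows that every formula has a translation. *)

Lemma steps_refl s : steps s s.
Proof. exact: Relation_Operators.rt1n_refl. Qed.

Lemma steps_trans s2 s1 s3 : steps s1 s2 -> steps s2 s3 -> steps s1 s3.
Proof.
move=> s12; elim: s12 s3 => // a b c ab _ IH s3 /IH.
exact: Relation_Operators.rt1n_trans.
Qed.

Lemma steps1 s1 s2 : step s1 s2 -> steps s1 s2.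
Proof. by move=> h; apply: Relation_Operators.rt1n_trans h (steps_refl _). Qed.

Lemma steps_frame a b U s U' s' :
  steps (U, s) (U', s') -> steps (U, a ++ s ++ b) (U', a ++ s' ++ b).
Proof.
pose P p q := steps (p.1, a ++ p.2 ++ b) (q.1, a ++ q.2 ++ b).
rewrite -/(P (U, s) (U', s')).
elim=> [p|p q r pq _ IH]; first exact: steps_refl.
apply: steps_trans IH; apply: steps1.
case: pq => V s1 s2 x A ys t rt uy ay /=.
have := step_rule (a ++ s1) (s2 ++ b) rt uy ay.
by rewrite -!catA.
Qed.

Definition converges U s := exists U' cs,
  steps (U, s) (U', map Done cs) /\ all pltl_clause cs.

Lemma converges_nil U : converges U [::].
Proof. by exists U, [::]; split=> //; apply: steps_refl. Qed.

Lemma converges_cat s1 s2 :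
  (forall U, converges U s1) -> (forall U, converges U s2) ->
  forall U, converges U (s1 ++ s2).
Proof.
move=> c1 c2 U; have [U1 [t1 [st1 a1]]] := c1 U.
have [U2 [t2 [st2 a2]]] := c2 U1.
exists U2, (t1 ++ t2); rewrite all_cat a1 a2 map_cat; split=> //.
apply: (@steps_trans (U1, map Done t1 ++ s2)).
  exact: (steps_frame [::] s2 st1).
by have := steps_frame (map Done t1) [::] st2; rewrite !cats0.
Qed.

Lemma converges_cons_done c s : pltl_clause c ->
  (forall U, converges U s) -> forall U, converges U (Done c :: s).
Proof.
move=> cc cs; apply: (@converges_cat [:: Done c]) => // U.
by exists U, [:: c]; rewrite /= cc; split=> //; apply: steps_refl.
Qed.

Lemma converges_cons_todo x A s : (forall U, converges U [:: Todo x A]) ->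
  (forall U, converges U s) -> forall U, converges U (Todo x A :: s).
Proof. exact: (@converges_cat [:: Todo x A]). Qed.

Lemma converges_rule U x A ys r :
  rule x A ys r -> uniq ys -> all [pred y | y \notin U] ys ->
  (forall V, converges V r) -> converges U [:: Todo x A].
Proof.
move=> rr uy ay cr; have [U' [cs [st ac]]] := cr (ys ++ U).
exists U', cs; split=> //; apply: steps_trans st.
by have := step_rule [::] [::] rr uy ay; rewrite /= cats0 => /steps1.
Qed.

Lemma ex_fresh (U : seq sym) : exists y, y \notin U.
Proof.
exists (\sum_(i <- U) i).+1; apply/negP => yU.
by have := leqnn (\sum_(i <- U) i).+1; rewrite {1}(big_rem _ yU) /= ltnNge leq_addr.
Qed.

Lemma ex_fresh3 (U : seq sym) : exists y z v : sym,
  uniq [:: y; z; v] /\ all [pred y | y \notin U] [:: y; z; v].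
Proof.
have [y yU] := ex_fresh U; have [z] := ex_fresh (y :: U).
have [v] := ex_fresh (z :: y :: U); rewrite !inE !negb_or.
move=> /and3P[vz vy vU] /andP[zy zU]; exists y, z, v.
by rewrite /= !inE !negb_or yU zU vU eq_sym zy (eq_sym y) vy (eq_sym z) vz.
Qed.

Fixpoint weight (A : form) : nat :=
  match A with
  | Var _ => 1
  | Tru | Fls => 2
  | Un o B => (if o is ONot then 1 else 2) + weight B
  | Bin OOr B C => 1 + weight B + weight C
  | Bin OAnd B C | Bin OImp B C => 3 + weight B + weight C
  | Bin _ B C => 10 + weight B + weight C
  end.

Lemma weight_gt0 A : 0 < weight A.
Proof. by case: A => // [[]|[]]. Qed.

Lemma weight_gt1 A : ~~ literal A -> 1 < weight A.
Proof.
by case: A => // [[] A|[] A B] _; rewrite /= ?addSn ?ltnS ?addn_gt0 ?weight_gt0.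
Qed.

Lemma lit_disjW A : literal A -> lit_disj A.
Proof. by case: A => // -[]. Qed.

Lemma not_lit_disj_weight A : ~~ lit_disj A -> 1 < weight A.
Proof. by move=> nA; apply: weight_gt1; apply: contra nA; apply: lit_disjW. Qed.

Ltac converge todo := repeat first
  [ exact: converges_nil
  | apply: (todo); [by rewrite /=; lia|]
  | apply: converges_cons_done; [by rewrite /= ?lit_disjW ?orbT|] ].

Lemma converges_form x A U : converges U [:: Todo x A].
Proof.
have [n] := ubnP (weight A); elim: n x A U => // n IH x A U; rewrite ltnS => An.
have todo z B s : weight B < weight A -> (forall V, converges V s) ->
    forall V, converges V (Todo z B :: s).
  by move=> BA; apply: converges_cons_todo => V; apply/IH/(leq_trans BA).
have [y yU] := ex_fresh U.
have rule0 r : rule x A [::] r -> (forall V, converges V r) ->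
    converges U [:: Todo x A].
  by move=> rr; apply: (converges_rule rr).
have rule1 r : rule x A [:: y] r -> (forall V, converges V r) ->
    converges U [:: Todo x A].
  by move=> rr; apply: (converges_rule rr); rewrite //= yU.
have [y' [z [v [u3 a3]]]] := ex_fresh3 U.
have rule3 r : rule x A [:: y'; z; v] r -> (forall V, converges V r) ->
    converges U [:: Todo x A].
  by move=> rr; apply: (converges_rule rr).
have [dA|ndA] := boolP (lit_disj A).
  apply: rule0 (rule_lit_disj x dA) _.
  do 2![apply: converges_cons_done; first by rewrite /= dA].
  exact: converges_nil.
case: A An todo rule0 rule1 rule3 ndA => [p|||[] A|[] A B] /= An todo rule0
  rule1 rule3 nd //.
- by apply: rule0 (rule_tru x) _; converge todo.
- by apply: rule0 (rule_fls x) _; converge todo.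
- case: A An todo rule0 rule1 rule3 nd => [p|||[] A|[] A B] /= An todo rule0
    rule1 rule3 nd //; have A0 := weight_gt0.
  + by apply: rule0 (rule_simplify x simplify_not_tru) _; converge todo.
  + by apply: rule0 (rule_simplify x simplify_not_fls) _; converge todo.
  + by apply: rule0 (rule_simplify x (simplify_not_not A)) _; converge todo.
  + by apply: rule1 (rule_not_next x A y) _; converge todo.
  + have := A0 A => *.
    by apply: rule1 (rule_not_sometime x A y) _; converge todo.
  + by apply: rule1 (rule_not_always x A y) _; converge todo.
  + by apply: rule0 (rule_not_or x A B) _; converge todo.
  + by apply: rule0 (rule_not_and x A B) _; converge todo.
  + by apply: rule0 (rule_not_imp x A B) _; converge todo.
  + have := A0 A; have := A0 B => *.
    by apply: rule3 (rule_not_until x A B y' z v) _; converge todo.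
  + have := A0 A; have := A0 B => *.
    by apply: rule3 (rule_not_unless x A B y' z v) _; converge todo.
- have [dA|ndA] := boolP (lit_disj A); last first.
    by apply: rule1 (rule_next x y ndA) _; converge todo.
  apply: rule0 (rule_next_lit_disj x dA) _.
  by apply: converges_cons_done converges_nil; rewrite /= dA orbT.
- have [lA|nA] := boolP (literal A).
    by apply: rule0 (rule_sometime_lit x lA) _; converge todo.
  by apply: rule1 (rule_sometime x y nA) _; converge todo.
- have A0 := weight_gt0 A; have [lA|nA] := boolP (literal A).
    by apply: rule1 (rule_always_lit x y lA) _; converge todo.
  by have := weight_gt1 nA => *; apply: rule1 (rule_always x y nA) _; converge todo.
- have A0 := weight_gt0 A; have B0 := weight_gt0 B.
  have [dA|ndA] := boolP (lit_disj A); last first.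
    have := not_lit_disj_weight ndA => *.
    by apply: rule1 (rule_or x ndA (replace_here_l _ _ _)) _; converge todo.
  have ndB : ~~ lit_disj B by move: nd; rewrite dA.
  have := not_lit_disj_weight ndB => *.
  by apply: rule1 (rule_or x ndB (replace_here_r _ _ _)) _; converge todo.
- by apply: rule0 (rule_and x A B) _; converge todo.
- by apply: rule0 (rule_imp x A B) _; converge todo.
- have A0 := weight_gt0 A; have B0 := weight_gt0 B.
  have [lA|nA] := boolP (literal A); last first.
    by have := weight_gt1 nA => *; apply: rule1 (rule_until_l x B y nA) _; converge todo.
  have [lB|nB] := boolP (literal B); last first.
    by have := weight_gt1 nB => *; apply: rule1 (rule_until_r x A y nB) _; converge todo.
  by apply: rule1 (rule_until_lit x y lA lB) _; converge todo.
- have A0 := weight_gt0 A; have B0 := weight_gt0 B.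
  have [lA|nA] := boolP (literal A); last first.
    by have := weight_gt1 nA => *; apply: rule1 (rule_unless_l x B y nA) _; converge todo.
  have [lB|nB] := boolP (literal B); last first.
    by have := weight_gt1 nB => *; apply: rule1 (rule_unless_r x A y nB) _; converge todo.
  by apply: rule1 (rule_unless_lit x y lA lB) _; converge todo.
Qed.

Lemma tau0_total W : exists cs, tau0 W cs.
Proof.
have [y yW] := ex_fresh (syms W).
have [U [cs [st ac]]] : converges (y :: syms W)
    [:: Done (Initial (Var y)); Todo y W].
  by apply: converges_cons_done => // U; apply: converges_form.
by exists cs, y, U.
Qed.

(* Main.v *)
(** Every formula gets a potential [cost] bounding the number of clauses that
    any run of the translation can still produce from it.  No rewrite rule
    increases the total potential of a conjunction, whatever the order of
    application, and the potential of [A] is at most [11 * len A]; the extreme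
    case is the rule for a negated unless, which adds [7] for an until between
    symbols and [4] for a conjunction of two symbols. *)

Require Import Defs.
From mathcomp Require Import all_boot.
From mathcomp Require Import zify.

Set Implicit Arguments.
Unset Strict Implicit.
Unset Printing Implicit Defensive.

(* [ncost A] is the cost of [Not A].  A literal argument is free because it is
   never replaced by a new symbol. *)
Fixpoint cost (A : form) : nat :=
  match A with
  | Var _ | Tru | Fls => 2
  | Not B => ncost B
  | Next B => 1 + if lit_disj B then 0 else cost B
  | Sometime B => 1 + if literal B then 0 else cost B
  | Always B => 6 + if literal B then 0 else cost B
  | Or B C => 2 + if lit_disj B && lit_disj C then 0 else
      (if literal B then 0 else cost B) + (if literal C then 0 else cost C)
  | And B C => cost B + cost C
  | Imp B C => 2 + ncost B + cost C
  | Until B C => 7 +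
      (if literal B then 0 else cost B) + (if literal C then 0 else cost C)
  | Unless B C => 6 +
      (if literal B then 0 else cost B) + (if literal C then 0 else cost C)
  end
with ncost (A : form) : nat :=
  match A with
  | Var _ | Tru | Fls => 2
  | Not B => cost B
  | Next B | Always B => 1 + ncost B
  | Sometime B => 6 + ncost B
  | Or B C => ncost B + ncost C
  | And B C => 2 + ncost B + ncost C
  | Imp B C => cost B + ncost C
  | Until B C => 10 + ncost B + ncost C
  | Unless B C => 11 + ncost B + ncost C
  end.

Lemma cost_le_len A : cost A <= 11 * len A /\ ncost A <= 11 * nlen A.
Proof.
elim: A => [p|||o A [cA nA]|o A [cA nA] B [cB nB]] //=.
  by case: o => /=; split=> //; do ?case: ifP => _; lia.
by case: o => /=; split=> //; do ?case: ifP => _; lia.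
Qed.

Lemma cost_lit_disj A : lit_disj A -> cost A = 2.
Proof. by case: A => // [[] // []|[] //= A B ->]. Qed.

(** The disjunct containing the redex is never a literal, so simplification starts from a subformula
    whose cost is charged, even when it ends in a free literal. *)
Lemma simplify_not_lit_disj A A' : simplify A A' -> lit_disj A = false.
Proof.
by elim=> // [[] // B B' []//|[] //= B B' C _ ->|[] //= B C C' _ ->]; rewrite ?andbF.
Qed.

Lemma simplify_cost A A' : simplify A A' ->
  cost A' <= cost A /\ ncost A' <= ncost A.
Proof.
have nl B B' : simplify B B' -> literal B = false.
  by move/simplify_not_lit_disj; apply: contraFF => /lit_disjW.
elim=> // [o B B' s [IH nIH]|o B B' C s [IH nIH]|o B C C' s [IH nIH]].
all: have /= l := nl _ _ s; have /= d := simplify_not_lit_disj s.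
all: case: o; split; rewrite //= ?l ?d ?andbF /=; do ?case: ifP => _; lia.
Qed.

(** The cost of [A] is charged in [E], while the symbol replacing it is free in [E']. The first two
    conclusions settle the literal tests of an enclosing [Or] in the induction. *)
Lemma replace_disjunct_cost A y E E' : ~~ lit_disj A ->
  replace_disjunct A (Var y) E E' ->
  [/\ lit_disj E = false, literal E' = false & cost E' + cost A <= cost E].
Proof.
move=> dA; have lA : literal A = false by apply: contraNF dA => /lit_disjW.
elim=> [B|B|F F' B _ [d l IH]|F F' B _ [d l IH]].
all: rewrite /= ?(negPf dA) ?lA ?d ?andbF; split=> //=.
3,4: have -> : literal F = false by apply: contraFF d => /lit_disjW.
all: rewrite ?l; do ?case: ifP => _; lia.
Qed.

Definition conjunct_cost (c : conjunct) : nat :=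
  if c is Todo _ A then cost A else 1.

Definition total_cost (s : seq conjunct) : nat := sumn (map conjunct_cost s).

Lemma rule_cost x A ys r : rule x A ys r -> total_cost r <= cost A.
Proof.
have dlE l : literal l -> lit_disj l /\ cost l = 2.
  by move=> /lit_disjW d; rewrite cost_lit_disj.
rewrite /total_cost; case=> /=.
  by move=> B B' /simplify_cost[cB _]; rewrite addn0.
all: try by move=> *; do ?case: ifP => _; lia.
(* These rules name a complex argument by a new symbol: the side condition excludes the free case,
   so the argument's cost pays for its own conjunct. *)
1-7: by move=> B *; do ?[case: ifP => ?]; lia.
- by move=> l y ll; have [_ ->] := dlE _ ll; rewrite ll.
- move=> l m y ll lm; have [-> _] := dlE _ ll; have [-> _] := dlE _ lm.
  by rewrite ll lm.
- move=> l m y ll lm; have [-> _] := dlE _ ll; have [-> _] := dlE _ lm.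
  by rewrite ll lm.
- by move=> B E E' y dB /(replace_disjunct_cost dB)[_ _]; rewrite addn0.
- by move=> D /cost_lit_disj ->.
Qed.

Lemma step_cost s t : step s t -> total_cost t.2 <= total_cost s.2.
Proof.
case=> U s1 s2 x A ys r /rule_cost; rewrite /total_cost /= !map_cat !sumn_cat /=.
lia.
Qed.

Lemma steps_cost s t : steps s t -> total_cost t.2 <= total_cost s.2.
Proof. by elim=> // u v w /step_cost uv _ vw; apply: leq_trans uv. Qed.

Lemma total_cost_Done cs : total_cost (map Done cs) = size cs.
Proof. by elim: cs => //= c cs <-. Qed.

Theorem theorem6 (W : form) (cs : seq clause) :
  tau0 W cs -> size cs <= 1 + 11 * len W.
Proof.
move=> [y [U [_ /steps_cost /= le_cs _]]].
have [cW _] := cost_le_len W.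
(* The extra 1 is the clause for [start]. *)
by move: le_cs; rewrite total_cost_Done /total_cost /= addn0; lia.
Qed.
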